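(* There is no non-flat $(2n+1)$-dimensional $\phi$-recurrent contact metric manifold of constant curvature. That is, for every $n\geq 1$, no contact metric manifold $M^{2n+1}(\phi,\xi,\eta,g)$ whose metric $g$ has constant sectional curvature $c\neq 0$ is $\phi$-recurrent.
   Context: A contact metric manifold $M^{2n+1}(\phi,\xi,\eta,g)$ is a smooth $(2n+1)$-dimensional manifold with a global 1-form $\eta$ satisfying $\eta\wedge(d\eta)^n\neq 0$ everywhere, a global vector field $\xi$, a $(1,1)$-tensor field $\phi$ and a Riemannian metric $g$ such that $\eta(\xi)=1$, $\phi^2=-\mathrm{Id}+\eta\otimes\xi$, $g(\phi X,\phi Y)=g(X,Y)-\eta(X)\eta(Y)$ and $d\eta(X,Y)=g(X,\phi Y)$ for all vector fields $X,Y$, with the convention $d\eta(X,Y)=\frac12\big(X\eta(Y)-Y\eta(X)-\eta([X,Y])\big)$. Let $\nabla$ be the Levi-Civita connection of $g$ and $R(X,Y)Z=\nabla_X\nabla_YZ-\nabla_Y\nabla_XZ-\nabla_{[X,Y]}Z$ its curvature tensor. Constant curvature $c$ means $R(X,Y)Z=c(g(Y,Z)X-g(X,Z)Y)$ for all $X,Y,Z$. A contact metric manifold is $\phi$-recurrent if there exists a non-zero (i.e. not identically zero) 1-form $A$ on $M$ such that $\phi^2((\nabla_WR)(X,Y)Z)=A(W)R(X,Y)Z$ for all vector fields $X,Y,Z,W$ on $M$. *)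

(* Defs.v *)
From HB Require Import structures.
From mathcomp Require Import all_boot all_order all_algebra all_fingroup ssrAC.
From mathcomp Require Import all_classical all_reals all_analysis.

Set Implicit Arguments.
Unset Strict Implicit.
Unset Printing Implicit Defensive.

Import Order.TTheory GRing.Theory Num.Theory.
Import numFieldNormedType.Exports.

Local Open Scope classical_set_scope.
Local Open Scope ring_scope.

(* Differential geometry in the module-theoretic style: vector fields are the
   derivations of the R-algebra C^oo(M), and tensor fields are C^oo(M)-linear
   maps between modules of vector fields and functions. *)

Lemma continuous_near_eq (T U : topologicalType) (f g : T -> U) (x : T) :
  {near x, f =1 g} -> {for x, continuous f} -> {for x, continuous g}.
Proof.
move=> fg cf; rewrite /prop_for /continuous_at -(nbhs_singleton fg).
by apply: cvg_trans cf; exact: near_eq_cvg.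
Qed.

Section Ck.
Context {R : realType} {m : nat}.
Implicit Types (U : set 'rV[R]_m) (f g : 'rV[R]_m -> R).

(* Only meaningful for open U; it depends only on the values of f on U. *)
Fixpoint Ck (k : nat) U f : Prop :=
  (forall x, U x -> {for x, continuous f}) /\
  if k is k'.+1 then
    forall j : 'I_m,
      (forall x, U x -> derivable f x 'e_j) /\
      Ck k' U (fun x => 'D_('e_j) f x)
  else True.

Definition smooth_on U f : Prop := forall k, Ck k U f.

Lemma Ck_ext k U f g : open U -> (forall x, U x -> f x = g x) ->
  Ck k U f -> Ck k U g.
Proof.
move=> oU.
have near_eq f' g' x : (forall x, U x -> f' x = g' x) -> U x ->
    {near x, f' =1 g'}.
  by move=> fg Ux; near=> y; apply: fg; near: y; exact: open_nbhs_nbhs.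
have cont_eq f' g' x : (forall x, U x -> f' x = g' x) -> U x ->
    {for x, continuous f'} -> {for x, continuous g'}.
  by move=> fg Ux; apply: continuous_near_eq; exact: near_eq.
elim: k f g => [|k IH] f g fg /= [cf H]; split => //.
- by move=> x Ux; apply: cont_eq fg Ux (cf x Ux).
- by move=> x Ux; apply: cont_eq fg Ux (cf x Ux).
move=> j; have [df Hf] := H j; split.
  by move=> x Ux; apply: near_eq_derivable (df x Ux); exact: near_eq.
by apply: IH Hf => x Ux; apply: near_eq_derive; exact: near_eq.
Unshelve. all: by end_near. Qed.

Lemma CkW k U f : Ck k.+1 U f -> Ck k U f.
Proof.
elim: k f => [|k IH] f [cf H]; split => // j.
by have [df Hf] := H j; split => //; apply: IH.
Qed.

Lemma Ck_cst k U (a : R) : open U -> Ck k U (cst a).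
Proof.
move=> oU; elim: k a => [|k IH] a; split => //;
  try by move=> x _; exact: cst_continuous.
move=> j; split; first by move=> x _; exact: derivable_cst.
by apply: Ck_ext oU _ (IH 0) => x _; rewrite derive_cst.
Qed.

Lemma CkD k U f g : open U -> Ck k U f -> Ck k U g -> Ck k U (f + g).
Proof.
move=> oU; elim: k f g => [|k IH] f g [cf Hf] [cg Hg]; split => //.
- by move=> x Ux; apply: continuousD; [exact: cf|exact: cg].
- by move=> x Ux; apply: continuousD; [exact: cf|exact: cg].
move=> j; have [df Cf] := Hf j; have [dg Cg] := Hg j; split.
  by move=> x Ux; apply: derivableD; [exact: df|exact: dg].
apply: Ck_ext oU _ (IH _ _ Cf Cg) => x Ux.
by rewrite deriveD; [|exact: df|exact: dg].
Qed.

Lemma CkM k U f g : open U -> Ck k U f -> Ck k U g -> Ck k U (f * g).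
Proof.
move=> oU; elim: k f g => [|k IH] f g Kf Kg.
  move: Kf Kg => [cf _] [cg _]; split => // x Ux.
  by apply: continuousM; [exact: cf|exact: cg].
have := (CkW Kf, CkW Kg); move: Kf Kg => [cf Hf] [cg Hg] [Wf Wg]; split.
  by move=> x Ux; apply: continuousM; [exact: cf|exact: cg].
move=> j; have [df Cf] := Hf j; have [dg Cg] := Hg j; split.
  by move=> x Ux; apply: derivableM; [exact: df|exact: dg].
apply: Ck_ext oU _ (CkD oU (IH _ _ Wf Cg) (IH _ _ Wg Cf)) => x Ux.
by rewrite deriveM; [|exact: df|exact: dg].
Qed.

End Ck.

Record chart (R : realType) (m : nat) (M : topologicalType) := Chart {
  chart_dom : set M;
  chart_cod : set 'rV[R]_m;
  chart_map : M -> 'rV[R]_m;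
  chart_inv : 'rV[R]_m -> M;
  chart_dom_open : open chart_dom;
  chart_cod_open : open chart_cod;
  chart_map_cod : forall p, chart_dom p -> chart_cod (chart_map p);
  chart_inv_dom : forall x, chart_cod x -> chart_dom (chart_inv x);
  chart_mapK : forall p, chart_dom p -> chart_inv (chart_map p) = p;
  chart_invK : forall x, chart_cod x -> chart_map (chart_inv x) = x;
  chart_map_continuous : forall p, chart_dom p -> {for p, continuous chart_map};
  chart_inv_continuous : forall x, chart_cod x -> {for x, continuous chart_inv}
}.

(* The transition map d o c^-1 is smooth on c(dom c `&` dom d). *)
Definition smooth_transition (R : realType) (m : nat) (M : topologicalType)
    (c d : chart R m M) : Prop :=
  forall j : 'I_m,
    smooth_on (chart_cod c `&` chart_inv c @^-1` chart_dom d)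
      (fun x => chart_map d (chart_inv c x) 0 j).

(* The atlas is not required to be maximal: any smooth atlas determines the
   smooth structure. *)
Record smoothManifold (R : realType) (m : nat) := SmoothManifold {
  manifold_space :> topologicalType;
  manifold_hausdorff : hausdorff_space manifold_space;
  manifold_second_countable : @second_countable manifold_space;
  atlas : set (chart R m manifold_space);
  atlas_cover : forall p, exists2 c, atlas c & chart_dom c p;
  atlas_smooth : forall c d, atlas c -> atlas d -> smooth_transition c d
}.

Section SmoothFunctions.
Context {R : realType} {m : nat} (M : smoothManifold R m).

Definition smooth_function (f : M -> R) : Prop :=
  forall c : chart R m M, atlas c -> smooth_on (chart_cod c) (f \o chart_inv c).

Definition smooth_pred : {pred M -> R} :=
  [pred f : M -> R | `[< smooth_function f >] ].

Lemma smooth_predP f : reflect (smooth_function f) (f \in smooth_pred).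
Proof. exact: asboolP. Qed.

Lemma smooth_cst (a : R) : (cst a : M -> R) \in smooth_pred.
Proof.
by apply/smooth_predP => c _ k; apply: Ck_cst; exact: chart_cod_open.
Qed.

Lemma smooth_predD f g :
  f \in smooth_pred -> g \in smooth_pred -> f + g \in smooth_pred.
Proof.
move=> /smooth_predP sf /smooth_predP sg; apply/smooth_predP => c cA k.
by apply: CkD (sf c cA k) (sg c cA k); exact: chart_cod_open.
Qed.

Lemma smooth_predM f g :
  f \in smooth_pred -> g \in smooth_pred -> f * g \in smooth_pred.
Proof.
move=> /smooth_predP sf /smooth_predP sg; apply/smooth_predP => c cA k.
by apply: CkM (sf c cA k) (sg c cA k); exact: chart_cod_open.
Qed.

Lemma smooth_predZ (a : R) f : f \in smooth_pred -> a *: f \in smooth_pred.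
Proof. exact: smooth_predM (smooth_cst a). Qed.

Lemma smooth_pred_subring : subring_closed smooth_pred.
Proof.
split; [exact: smooth_cst| |exact: smooth_predM] => f g sf sg.
by apply: smooth_predD => //; rewrite -scaleN1r; exact: smooth_predZ.
Qed.

Lemma smooth_pred_submod : GRing.subsemimod_closed smooth_pred.
Proof.
split; last exact: smooth_predZ.
by split; [exact: smooth_cst|exact: smooth_predD].
Qed.

Record smoothFun := SmoothFun {
  smooth_val :> M -> R;
  smooth_valP : smooth_val \in smooth_pred
}.

HB.instance Definition _ := [isSub for smooth_val].
HB.instance Definition _ := [Choice of smoothFun by <:].
HB.instance Definition _ := GRing.SubChoice_isSubComPzRing.Build
  (M -> R) smooth_pred smoothFun smooth_pred_subring.
HB.instance Definition _ := GRing.SubZmodule_isSubLmodule.Build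
  R (M -> R) smooth_pred smoothFun smooth_pred_submod.

End SmoothFunctions.

Section VectorFields.
Context {R : realType} {m : nat} (M : smoothManifold R m).

Definition derivation (D : smoothFun M -> smoothFun M) : Prop :=
  (forall (a : R) f g, D (a *: f + g) = a *: D f + D g) /\
  (forall f g, D (f * g) = D f * g + f * D g).

Definition derivation_pred : {pred smoothFun M -> (smoothFun M)^o} :=
  [pred D : smoothFun M -> (smoothFun M)^o | `[< derivation D >] ].

Lemma derivation_predP D : reflect (derivation D) (D \in derivation_pred).
Proof. exact: asboolP. Qed.

Lemma smooth_scaleA (a : R) (h f : smoothFun M) : h * (a *: f) = a *: (h * f).
Proof.
apply: val_inj; apply: funext => p.
by rewrite /= mulrCA.
Qed.

Lemma derivation_pred_submod : submod_closed derivation_pred.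
Proof.
split.
  apply/derivation_predP; split=> [a f g|f g] /=.
    by rewrite scaler0 addr0.
  by rewrite mul0r mulr0 addr0.
move=> h D E /derivation_predP[D1 D2] /derivation_predP[E1 E2].
apply/derivation_predP; split=> [a f g|f g].
  change (h * D (a *: f + g) + E (a *: f + g)
    = a *: (h * D f + E f) + (h * D g + E g) :> smoothFun M).
  by rewrite D1 E1 mulrDr smooth_scaleA scalerDr addrACA.
change (h * D (f * g) + E (f * g)
  = (h * D f + E f) * g + f * (h * D g + E g) :> smoothFun M).
by rewrite D2 E2 !mulrDr mulrDl addrACA !mulrA [h * f]mulrC.
Qed.

Record vectorField := VectorField {
  vf_val : smoothFun M -> (smoothFun M)^o;
  vf_valP : vf_val \in derivation_pred
}.

HB.instance Definition _ := [isSub for vf_val].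
HB.instance Definition _ := [Choice of vectorField by <:].
HB.instance Definition _ := GRing.SubChoice_isSubLmodule.Build
  (smoothFun M) (smoothFun M -> (smoothFun M)^o) derivation_pred vectorField
  derivation_pred_submod.

Definition vf_apply (X : vectorField) (f : smoothFun M) : smoothFun M :=
  vf_val X f.

Coercion vf_apply : vectorField >-> Funclass.

Lemma vf_derivation X : derivation (vf_apply X).
Proof. by apply/derivation_predP; exact: vf_valP. Qed.

Lemma lie_subproof (X Y : vectorField) :
  ((fun f => X (Y f) - Y (X f))
     : smoothFun M -> (smoothFun M)^o) \in derivation_pred.
Proof.
have [X1 X2] := vf_derivation X; have [Y1 Y2] := vf_derivation Y.
have XD f g : X (f + g) = X f + X g.
  by rewrite -[f]scale1r X1 !scale1r.
have YD f g : Y (f + g) = Y f + Y g.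
  by rewrite -[f]scale1r Y1 !scale1r.
apply/derivation_predP; split=> [a f g|f g].
  by rewrite Y1 X1 X1 Y1 scalerBr opprD addrACA.
rewrite X2 Y2 XD YD !X2 !Y2 mulrBl mulrBr !opprD !addrA.
move: (X (Y f) * g) (f * X (Y g)) => a b.
move: (Y (X f) * g) (f * Y (X g)) => c d.
move: (X f * Y g) (Y f * X g) => u v.
by rewrite [LHS](ACl (1*5*4*8*(2*7)*(3*6))%AC) /= !subrr !addr0.
Qed.

Definition lie_bracket (X Y : vectorField) : vectorField :=
  VectorField (lie_subproof X Y).

End VectorFields.

Section Forms.
Context {R : realType} {m : nat} {M : smoothManifold R m}.

Definition oneForm := {scalar vectorField M}.

(* The underlying map of a k-form; being alternating and multilinear is not part
   of the type. *)
Definition diffForm (k : nat) := ('I_k -> vectorField M) -> smoothFun M.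

Definition form_of_oneForm (w : oneForm) : diffForm 1 := fun v => w (v ord0).

Definition ext_deriv (w : oneForm) (X Y : vectorField M) : smoothFun M :=
  2^-1 *: (X (w Y) - Y (w X) - w (lie_bracket X Y)).

Definition ext_deriv_form (w : oneForm) : diffForm 2 :=
  fun v => ext_deriv w (v ord0) (v ord_max).

(* The wedge product a /\ b = Alt (a (x) b), where Alt is the antisymmetrization
   with the factor 1/(p+q)!; this is the normalization that goes with the factor
   1/2 in ext_deriv. *)
Definition wedge (p q : nat) (a : diffForm p) (b : diffForm q) : diffForm (p + q) :=
  fun v => ((p + q)`!%:R : R)^-1 *:
    \sum_(s : 'S_(p + q)) (-1) ^+ s *
      (a (fun i => v (s (lshift q i))) * b (fun j => v (s (rshift p j)))).

Fixpoint wedge_pow (p : nat) (a : diffForm p) (n : nat) : diffForm (n * p) :=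
  match n with
  | 0 => fun _ => 1
  | n'.+1 => wedge a (@wedge_pow p a n')
  end.

Definition form_nonvanishing (k : nat) (a : diffForm k) : Prop :=
  forall p : M, exists v, a v p != 0.

End Forms.

Arguments oneForm {R m} M.
Arguments wedge_pow {R m M p} a n.

Section Riemannian.
Context {R : realType} {m : nat} (M : smoothManifold R m).

(* X_p <> 0, where the tangent vector X_p is the derivation f |-> (X f)(p). *)
Definition nonzero_at (X : vectorField M) (p : M) : Prop :=
  exists f : smoothFun M, X f p != 0.

Record riemannianMetric := RiemannianMetric {
  metric :> vectorField M -> vectorField M -> smoothFun M;
  metric_sym : forall X Y, metric X Y = metric Y X;
  metric_linear : forall (f : smoothFun M) X Y Z,
    metric (f *: X + Y) Z = f * metric X Z + metric Y Z;
  metric_pos : forall X p, nonzero_at X p -> 0 < metric X X p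
}.

Implicit Types (X Y Z W : vectorField M).

Definition affine_connection (nabla : vectorField M -> vectorField M -> vectorField M)
    : Prop :=
  [/\ forall (f : smoothFun M) X Y Z,
        nabla (f *: X + Y) Z = f *: nabla X Z + nabla Y Z,
      forall X Y Z, nabla X (Y + Z) = nabla X Y + nabla X Z
    & forall X (f : smoothFun M) Y, nabla X (f *: Y) = X f *: Y + f *: nabla X Y].

(* By Koszul's formula, at most one nabla satisfies this for a given g. *)
Definition levi_civita (g : riemannianMetric)
    (nabla : vectorField M -> vectorField M -> vectorField M) : Prop :=
  [/\ affine_connection nabla,
      forall X Y, nabla X Y - nabla Y X = lie_bracket X Y
    & forall X Y Z, X (g Y Z) = g (nabla X Y) Z + g Y (nabla X Z)].

Definition curvature (nabla : vectorField M -> vectorField M -> vectorField M) X Y Z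
    : vectorField M :=
  nabla X (nabla Y Z) - nabla Y (nabla X Z) - nabla (lie_bracket X Y) Z.

Definition curvature_cov_deriv
    (nabla : vectorField M -> vectorField M -> vectorField M) W X Y Z
    : vectorField M :=
  nabla W (curvature nabla X Y Z)
  - curvature nabla (nabla W X) Y Z
  - curvature nabla X (nabla W Y) Z
  - curvature nabla X Y (nabla W Z).

Definition const_fun (c : R) : smoothFun M := SmoothFun (smooth_cst M c).

Definition constant_curvature (g : riemannianMetric)
    (nabla : vectorField M -> vectorField M -> vectorField M) (c : R) : Prop :=
  forall X Y Z,
    curvature nabla X Y Z = const_fun c *: (g Y Z *: X - g X Z *: Y).

End Riemannian.

Record contactMetricStructure (R : realType) (n : nat)
    (M : smoothManifold R (2 * n + 1)) := ContactMetricStructure {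
  contact_phi : {linear vectorField M -> vectorField M};
  contact_xi : vectorField M;
  contact_eta : oneForm M;
  contact_metric : riemannianMetric M;
  contact_nonvanishing :
    form_nonvanishing
      (wedge (form_of_oneForm contact_eta)
             (wedge_pow (ext_deriv_form contact_eta) n));
  contact_eta_xi : contact_eta contact_xi = 1;
  contact_phi2 : forall X,
    contact_phi (contact_phi X) = - X + contact_eta X *: contact_xi;
  contact_metric_phi : forall X Y,
    contact_metric (contact_phi X) (contact_phi Y) =
      contact_metric X Y - contact_eta X * contact_eta Y;
  contact_ext_deriv : forall X Y,
    ext_deriv contact_eta X Y = contact_metric X (contact_phi Y)
}.

Definition phi_recurrent (R : realType) (n : nat)
    (M : smoothManifold R (2 * n + 1)) (S : contactMetricStructure M)
    (nabla : vectorField M -> vectorField M -> vectorField M) : Prop :=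
  exists2 A : oneForm M, (exists W, A W != 0) &
    forall X Y Z W,
      contact_phi S (contact_phi S (curvature_cov_deriv nabla W X Y Z)) =
        A W *: curvature nabla X Y Z.

(* Main.v *)
Require Import Defs.
From mathcomp Require Import all_boot all_order all_algebra all_reals.
From mathcomp Require Import boolp topology_structure.

Import GRing.Theory.

Local Open Scope ring_scope.

(** Constant curvature makes the curvature tensor a constant multiple of
    g(Y,Z)X - g(X,Z)Y, and this tensor is parallel because g is
    ([curvature_cov_deriv_eq0]): the covariant derivative of R vanishes.
    Recurrence then says that A(W) R(X,Y)Z = 0 for all fields.

    At a point p with A(W)(p) <> 0 this forces R to vanish, which the contact
    structure rules out when c <> 0.  The structure tensors satisfy
    eta o phi = 0 and eta = g(., xi), whence R(phi V, xi)xi = c phi V, and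
    pairing with U gives A(W) c d eta(U, V) = 0 for all U, V.  Thus d eta
    vanishes at p; since n >= 1, the form eta /\ (d eta)^n has d eta as a
    factor and vanishes at p too, against the contact condition. *)

Section Riemannian.
Context {R : realType} {m : nat} {M : smoothManifold R m}.
Implicit Types (X Y Z W : vectorField M) (g : riemannianMetric M).

Lemma metric0r g X : g X 0 = 0.
Proof.
have := metric_linear g 1 0 0 X; rewrite scale1r addr0 mul1r metric_sym.
by move/eqP; rewrite -subr_eq0 opprD addrA subrr sub0r oppr_eq0 => /eqP.
Qed.

Lemma metricZr g (f : smoothFun M) X Y : g X (f *: Y) = f * g X Y.
Proof.
rewrite metric_sym -[f *: Y]addr0 metric_linear.
by rewrite ![g _ X]metric_sym metric0r addr0.
Qed.

Lemma vf_const_fun X (c : R) : X (const_fun M c) = 0.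
Proof.
have [Xlin Xmul] := vf_derivation X.
have X1 : X 1 = 0.
  have := Xmul 1 1; rewrite !mulr1 mul1r.
  by move/eqP; rewrite -subr_eq0 opprD addrA subrr sub0r oppr_eq0 => /eqP.
have X0 : X 0 = 0.
  by have := Xmul 0 0; rewrite !mul0r mulr0 addr0.
have -> : const_fun M c = c *: (1 : smoothFun M).
  by apply: val_inj; apply: funext => p; exact: esym (mulr1 c).
by rewrite -[c *: _]addr0 Xlin X1 X0 scaler0 addr0.
Qed.

Section LeviCivita.
Context {g : riemannianMetric M}.
Context {nabla : vectorField M -> vectorField M -> vectorField M}.
Context (nablaLC : levi_civita g nabla).

Lemma nablaB W X Y : nabla W (X - Y) = nabla W X - nabla W Y.
Proof.
have [[_ nablaD _] _ _] := nablaLC.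
by apply/eqP; rewrite eq_sym subr_eq -nablaD subrK.
Qed.

Lemma nabla_const_funZ W (c : R) X :
  nabla W (const_fun M c *: X) = const_fun M c *: nabla W X.
Proof.
have [[_ _ nablaZ] _ _] := nablaLC.
by rewrite nablaZ vf_const_fun scale0r add0r.
Qed.

(** The tensor g (x) Id is parallel: the Leibniz rule for the connection
    combined with its compatibility with the metric. *)
Lemma nabla_metricZ W X Y Z :
  nabla W (g Y Z *: X)
  = g Y Z *: nabla W X + g (nabla W Y) Z *: X + g Y (nabla W Z) *: X.
Proof.
have [[_ _ nablaZ] _ nabla_g] := nablaLC.
by rewrite nablaZ -addrA -scalerDl -nabla_g addrC.
Qed.

(** A constant-curvature tensor is assembled from the metric and a constant,
    both parallel, so the manifold is locally symmetric. *)
Lemma curvature_cov_deriv_eq0 {c : R} :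
  constant_curvature g nabla c ->
  forall W X Y Z, curvature_cov_deriv nabla W X Y Z = 0.
Proof.
move=> Rc W X Y Z; rewrite /curvature_cov_deriv !Rc nabla_const_funZ -!scalerBr.
have sub3_eq0 (V V1 V2 V3 : vectorField M) :
    V = V1 + V2 + V3 -> V - V1 - V2 - V3 = 0.
  by move=> ->; rewrite -!addrA -!opprD !addrA subrr.
rewrite sub3_eq0 ?scaler0 // nablaB !nabla_metricZ.
(* With the first two terms of the second derivative swapped, the six terms
   pair up as R(nabla X, Y)Z, R(X, nabla Y)Z and R(X, Y)nabla Z. *)
rewrite [g X Z *: nabla W Y + _]addrC !opprD.
by rewrite [LHS]addrACA [X in X + _ = _]addrACA.
Qed.

End LeviCivita.
End Riemannian.

Section Forms.
Context {R : realType} {m : nat} {M : smoothManifold R m}.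

Lemma wedge_eq0 (k l : nat) (a : diffForm k) (b : diffForm l) (p : M) :
  (forall v w, a v p * b w p = 0) -> forall v, wedge a b v p = 0.
Proof.
move=> ab0 v; rewrite /wedge /=.
suff s0 : forall f : smoothFun M, f p = 0 ->
  (((k + l)`!%:R : R)^-1 *: f) p = 0.
  apply: s0; elim/big_ind: _ => // [f h f0 h0|s _].
    by rewrite -[LHS]/(f p + h p) f0 h0 addr0.
  by rewrite -[LHS]/(_ * (a _ p * b _ p)) ab0 mulr0.
by move=> f f0; rewrite -[LHS]/(_ * f p) f0 mulr0.
Qed.

End Forms.

Section ContactMetric.
Context {R : realType} {n : nat} {M : smoothManifold R (2 * n + 1)}.
Context (S : contactMetricStructure M).
Notation phi := (contact_phi S).
Notation xi := (contact_xi S).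
Notation eta := (contact_eta S).
Notation g := (contact_metric S).

(** The two ways of computing phi^3, as phi^2 o phi and as phi o phi^2, differ
    by these terms. *)
Lemma contact_phi3 X : eta (phi X) *: xi = eta X *: phi xi.
Proof.
have := contact_phi2 S (phi X).
rewrite [phi (phi X)]contact_phi2 linearD linearN linearZ /=.
by move/addrI.
Qed.

(** [contact_phi3] at xi says phi xi = eta(phi xi) xi; applying phi once more
    gives eta(phi xi)^2 = 0, and the ring of functions is reduced. *)
Lemma contact_phi_xi : phi xi = 0.
Proof.
have phixi : phi xi = eta (phi xi) *: xi.
  by rewrite contact_phi3 contact_eta_xi scale1r.
have phi2xi : phi (phi xi) = 0.
  by rewrite contact_phi2 contact_eta_xi scale1r addNr.
have sq0 : eta (phi xi) * eta (phi xi) = 0.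
  have := congr1 eta phi2xi; rewrite {1}phixi linearZ /=.
  by rewrite [in X in X -> _]linearZ linear0.
suff e0 : eta (phi xi) = 0 by rewrite phixi e0 scale0r.
apply: val_inj; apply: funext => p.
have /eqP := congr1 (fun f : smoothFun M => f p) sq0.
by rewrite /= mulf_eq0 orbb => /eqP.
Qed.

Lemma contact_eta_phi X : eta (phi X) = 0.
Proof.
have := congr1 eta (contact_phi3 X).
by rewrite contact_phi_xi scaler0 linear0 linearZ /= contact_eta_xi mulr1.
Qed.

Lemma contact_metric_xi X : g X xi = eta X.
Proof.
have := contact_metric_phi S X xi.
rewrite contact_phi_xi contact_eta_xi mulr1 metric0r.
by move/esym/eqP; rewrite subr_eq0 => /eqP.
Qed.

(** For n > 0 the form eta /\ (d eta)^n has d eta as a factor, so it would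
    vanish wherever d eta does. *)
Lemma ext_deriv_eta_neq0 (p : M) :
  (0 < n)%N -> exists X Y, ext_deriv eta X Y p != 0.
Proof.
move=> n_gt0; apply: contrapT => deta0.
have {}deta0 X Y : ext_deriv eta X Y p = 0.
  by apply/eqP/negP => /negP dXY; apply: deta0; exists X, Y.
have [v /eqP[]] := contact_nonvanishing S p.
have pow0 k w : (0 < k)%N ->
    wedge_pow (ext_deriv_form eta) k w p = 0.
  case: k w => // k w _ /=; apply: wedge_eq0 => u u'.
  by rewrite /ext_deriv_form deta0 mul0r.
by apply: wedge_eq0 => u w; rewrite pow0 // mulr0.
Qed.

(** The xi-sections detect the curvature: R(phi Y, xi)xi = c phi Y, and the
    pairing of phi Y with X is d eta(X, Y). *)
Lemma metric_curvature_xi {nabla} {c : R} X Y :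
  constant_curvature g nabla c ->
  g X (curvature nabla (phi Y) xi xi) = const_fun M c * ext_deriv eta X Y.
Proof.
move=> ->; rewrite !contact_metric_xi contact_eta_xi contact_eta_phi.
by rewrite scale1r scale0r subr0 metricZr contact_ext_deriv.
Qed.

End ContactMetric.

Theorem theorem4p14 (R : realType) (n : nat) (hn : (1 <= n)%N)
    (M : smoothManifold R (2 * n + 1)) (S : contactMetricStructure M)
    (nabla : vectorField M -> vectorField M -> vectorField M)
    (hnabla : levi_civita (contact_metric S) nabla)
    (c : R) (hc : c != 0)
    (hcurv : constant_curvature (contact_metric S) nabla c) :
  ~ phi_recurrent S nabla.
Proof.
case=> A [W AW0] recA; apply/negP: AW0; rewrite negbK; apply/eqP.
apply: val_inj; apply: funext => p.
have [X [Y dXY]] := ext_deriv_eta_neq0 S p hn.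
have := recA (contact_phi S Y) (contact_xi S) (contact_xi S) W.
rewrite (curvature_cov_deriv_eq0 hnabla hcurv) !linear0.
move/(congr1 (contact_metric S X)).
rewrite metricZr (metric_curvature_xi S X Y hcurv) metric0r.
move/(congr1 (fun f : smoothFun M => f p)).
rewrite -[RHS]/(A W p * (c * ext_deriv (contact_eta S) X Y p)) => /esym/eqP.
by rewrite 2!mulf_eq0 (negPf hc) (negPf dXY) !orbF => /eqP.
Qed.
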